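(* Let $q$ be an arbitrary complex number or an indeterminate. Let $\mathbf{MR}$ be the Mantaci-Reutenauer algebra of level $2$, with internal product $*$. Let $\mathring{\mathcal Q}=\mathbf{MR}^\sharp$ be the image of the $\sharp$ transform $F\mapsto F^\sharp=F*\sigma_1^\sharp$, where $\sigma_1^\sharp=\sum_{i,j\ge 0}(-q)^i\Lambda_{\bar i}S_j$, and let $\mathcal Q=\sum_{n\ge 0}S_n\,\mathring{\mathcal Q}$ be the right $\mathring{\mathcal Q}$-module (for the ordinary product of $\mathbf{MR}$) generated by the $S_n$, for all $n\ge 0$. Then $\mathcal Q$ is a $*$-subalgebra of $\mathbf{MR}$, containing $\mathring{\mathcal Q}$ as a left ideal (for the product $*$).
   Context: The ground field is $\mathbb{C}$ (or $\mathbb{C}(q)$ when $q$ is an indeterminate). $\mathbf{MR}$ is the free associative unital algebra on two sequences of generators $S_n$ and $S_{\bar n}$ ($n\ge 1$), with $\deg S_n=\deg S_{\bar n}=n$ and $S_0=S_{\bar 0}=1$; that is, the free product of two copies of the algebra $\mathbf{Sym}$ of noncommutative symmetric functions. It is a graded bialgebra (Hopf algebra) for the algebra morphism $\Delta$ with $\Delta S_n=\sum_{i+j=n}S_i\otimes S_j$ and $\Delta S_{\bar n}=\sum_{i+j=n}S_{\bar i}\otimes S_{\bar j}$; i.e. the series $\sigma_1=\sum_{n\ge 0}S_n$ and $\bar\sigma_1=\sum_{n\ge 0}S_{\bar n}$ are grouplike. The map $F\mapsto\bar F$ is the involutive algebra automorphism exchanging $S_n$ and $S_{\bar n}$. The elements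 $\Lambda_n$ are defined by $\Lambda_0=1$ and $\sum_{i+j=n}(-1)^i\Lambda_i S_j=0$ for $n\ge 1$, and $\Lambda_{\bar n}=\overline{\Lambda_n}$. The internal product $*$ is the bilinear associative product on $\mathbf{MR}$ such that $F*G=0$ for $F,G$ homogeneous of different degrees, and which is determined by the following: $\sigma_1$ is neutral (i.e. $S_n$ is the neutral element of the degree $n$ component), $\bar\sigma_1$ is central with $\bar\sigma_1*\bar\sigma_1=\sigma_1$ and $\bar\sigma_1*F=F*\bar\sigma_1=\bar F$ (so $S_{\bar n}*F=F*S_{\bar n}=\bar F$ for $F$ homogeneous of degree $n$), and the splitting formula holds: $(F_1\cdots F_k)*G=\mu_k\big((F_1\otimes\cdots\otimes F_k)*_k\Delta^kG\big)$ whenever each $F_i$ is one of the generators $S_n,S_{\bar n}$ and $G\in\mathbf{MR}$, where $\Delta^k$ is the iterated coproduct with values in $\mathbf{MR}^{\otimes k}$, $*_k$ is the componentwise internal product, and $\mu_k$ is the $k$-fold ordinary multiplication. In $F*\sigma_1^\sharp$, the infinite sum $\sigma_1^\sharp$ is used degree by degree: if $F$ is homogeneous of degree $n$, then $F^\sharp=F*\sum_{i+j=n}(-q)^i\Lambda_{\bar i}S_j$. ($\sigma_1^\sharp$ is also denoted $\sigma_1(A-q\bar A)$.) *)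

(* Defs.v *)
From HB Require Import structures.
From mathcomp Require Import all_boot all_order all_algebra.
From mathcomp Require Import finmap monalg.

Set Implicit Arguments.
Unset Strict Implicit.
Unset Printing Implicit Defensive.

Import GRing.Theory.
Local Open Scope ring_scope.

(* The letter (b, n) stands for S_(n+1) if b = false and for the barred
   generator if b = true: the index is shifted since S_0 = 1 is not a
   generator. *)
Definition letter : choiceType := (bool * nat)%type.

Definition word : monomType := {fmonom letter}.

Definition lbar (x : letter) : letter := (~~ x.1, x.2).

Definition ldeg (x : letter) : nat := x.2.+1.

Definition wdeg (w : word) : nat := (\sum_(x <- (w : seq letter)) ldeg x)%N.

Section ProductMonoid.
Variables M N : monomType.
Implicit Types p : M * N.

Definition pmone : M * N := (mone, mone).
Definition pmmul p1 p2 : M * N := (mmul p1.1 p2.1, mmul p1.2 p2.2).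

Lemma pmmulA : associative pmmul.
Proof. by move=> p1 p2 p3; rewrite /pmmul !Monoid.mulmA. Qed.

Lemma pmmul1m : left_id pmone pmmul.
Proof. by case=> x y; rewrite /pmmul !Monoid.mul1m. Qed.

Lemma pmmulm1 : right_id pmone pmmul.
Proof. by case=> x y; rewrite /pmmul !Monoid.mulm1. Qed.

Lemma pmmul_eq1 p1 p2 : pmmul p1 p2 = pmone -> p1 = pmone /\ p2 = pmone.
Proof.
by case: p1 p2 => [x1 y1] [x2 y2] [/unitm [/= -> ->] /unitm [/= -> ->]].
Qed.

HB.instance Definition _ := Choice_isMonomialDef.Build (M * N)%type
  pmmulA pmmul1m pmmulm1 pmmul_eq1.
End ProductMonoid.

Section MantaciReutenauer.
Variable K : fieldType.

Local Notation MR := {malg K[word]}.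

(* MR (x) MR with its componentwise algebra structure, on the basis of pairs
   of words. *)
Local Notation MR2 := {malg K[(word * word)%type]}.

(* The tensor algebra of MR, that is the direct sum of the tensor powers of MR:
   its basis is the free monoid on the set of words, and its product is the
   tensor product. *)
Local Notation TMR := {malg K[{fmonom word}]}.

Definition linext (B : choiceType) (A : lalgType K) (f : B -> A)
  (g : {malg K[B]}) : A := mmap (in_alg A) f g.

Definition algext (A : lalgType K) (f : letter -> A) (F : MR) : A :=
  linext (fun w : word => \prod_(x <- (w : seq letter)) f x) F.

Lemma linextU (B : choiceType) (A : lalgType K) (f : B -> A) (b : B) :
  linext f << b >> = f b.
Proof. by rewrite /linext mmapU /= scale1r mul1r. Qed.

Lemma linextP (B : choiceType) (A : lalgType K) (f : B -> A) (a : K)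
  (g1 g2 : {malg K[B]}) :
  linext f (a *: g1 + g2) = a *: linext f g1 + linext f g2.
Proof.
rewrite /linext mmapD; congr (_ + _).
rewrite (mmapEw (msuppZ_le _ _)) mmapE scaler_sumr.
by apply: eq_bigr => b _; rewrite mcoeffZ /= -!scalerAl !mul1r scalerA.
Qed.

Lemma algext1 (A : lalgType K) (f : letter -> A) : algext f 1 = 1.
Proof. by rewrite /algext linextU fm1 big_nil. Qed.

Lemma malg_scalerAr (M : monomType) (a : K) (g1 g2 : {malg K[M]}) :
  a *: (g1 * g2) = g1 * (a *: g2).
Proof.
rewrite (malgMEw (fsubset_refl _) (msuppZ_le a g2)) malgME scaler_sumr.
apply: eq_bigr => u _; rewrite scaler_sumr; apply: eq_bigr => v _.
apply/malgP => w; rewrite !mcoeffZ !mcoeffU.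
by rewrite mulrnAr mulrCA.
Qed.

Lemma algextM (M : monomType) (f : letter -> {malg K[M]}) :
  {morph algext f : F G / F * G}.
Proof.
move=> F G; rewrite /algext /linext malgME raddf_sum mulr_suml /=.
apply: eq_bigr => u _; rewrite raddf_sum mulr_sumr /=.
apply: eq_bigr => v _; rewrite mmapU /= fmM big_cat /= -!scalerAl !mul1r.
by rewrite -malg_scalerAr scalerA.
Qed.

Definition gen (x : letter) : MR := << fmu x >>.

Lemma algext_gen (A : lalgType K) (f : letter -> A) x : algext f (gen x) = f x.
Proof. by rewrite /algext linextU fmU big_seq1. Qed.

Definition Sb (b : bool) (n : nat) : MR := if n is m.+1 then gen (b, m) else 1.
Definition Sn : nat -> MR := Sb false.

Definition bar : MR -> MR := algext (fun x => gen (lbar x)).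

Definition tensor (F G : MR) : MR2 :=
  linext (fun u : word => linext (fun v : word => << (u, v) >> : MR2) G) F.

Lemma barM : {morph bar : F G / F * G}.
Proof. exact: algextM. Qed.

Lemma bar_Sb b n : bar (Sb b n) = Sb (~~ b) n.
Proof. by case: n => [|n]; rewrite /bar /= ?algext1 ?algext_gen. Qed.

Lemma tensorUU u v : tensor << u >> << v >> = << (u, v) >>.
Proof. by rewrite /tensor !linextU. Qed.

Definition coprod : MR -> MR2 :=
  algext (fun x =>
    \sum_(i < (ldeg x).+1) tensor (Sb x.1 i) (Sb x.1 (ldeg x - i))).

Lemma coprodM : {morph coprod : F G / F * G}.
Proof. exact: algextM. Qed.

Lemma coprod_Sb b n :
  coprod (Sb b n) = \sum_(i < n.+1) tensor (Sb b i) (Sb b (n - i)).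
Proof.
case: n => [|n]; last by rewrite /coprod algext_gen.
by rewrite big_ord1 /= /coprod algext1 tensorUU.
Qed.

(* Iterated coproduct, with values in the k-th tensor power of MR; it is the
   counit for k = 0 and the identity for k = 1. *)
Fixpoint itcoprod (k : nat) (G : MR) : TMR :=
  if k is k'.+1 then
    linext (fun p : word * word => << fmu p.1 >> * itcoprod k' << p.2 >>)
      (coprod G)
  else (G@_mone)%:A.

(* The internal product of a generator and of a word. *)
Definition genstar (x : letter) (u : word) : MR :=
  if ldeg x == wdeg u then (if x.1 then bar << u >> else << u >>) else 0.

(* The splitting formula for the product of the letters of w. *)
Definition wstar (w : word) (G : MR) : MR :=
  linext (fun t : {fmonom word} =>
      \prod_(p <- zip (w : seq letter) (t : seq word)) genstar p.1 p.2)
    (itcoprod (size w) G).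

Definition star (F G : MR) : MR := linext (fun w : word => wstar w G) F.

(* [:: Lambda_0; ...; Lambda_n] *)
Fixpoint Lambda_seq (n : nat) : seq MR :=
  if n is m.+1 then
    rcons (Lambda_seq m) ((-1) ^+ m *:
      \sum_(i < m.+1) (-1) ^+ i *: ((Lambda_seq m)`_i * Sn (m.+1 - i)))
  else [:: 1].

Definition Lambda (n : nat) : MR := (Lambda_seq n)`_n.

Lemma size_Lambda_seq n : size (Lambda_seq n) = n.+1.
Proof. by elim: n => //= n IHn; rewrite size_rcons IHn. Qed.

Lemma nth_Lambda_seq n i : (i <= n)%N -> (Lambda_seq n)`_i = Lambda i.
Proof.
elim: n => [|n IHn]; first by rewrite leqn0 => /eqP ->.
rewrite leq_eqVlt => /predU1P [-> //|lt_in].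
by rewrite /= nth_rcons size_Lambda_seq lt_in IHn.
Qed.

Lemma Lambda0 : Lambda 0 = 1.
Proof. by []. Qed.

Lemma Lambda_rel n : (0 < n)%N ->
  \sum_(i < n.+1) (-1) ^+ i *: (Lambda i * Sn (n - i)) = 0.
Proof.
case: n => // n _; rewrite big_ord_recr /= subnn mulr1 /Lambda /=.
rewrite nth_rcons size_Lambda_seq ltnn eqxx scalerA exprS mulN1r mulNr.
rewrite -exprD addnn -signr_odd odd_double expr0 scaleN1r.
apply/eqP; rewrite subr_eq0; apply/eqP/eq_bigr => i _.
have le_in : (i <= n)%N by rewrite -ltnS.
by rewrite (nth_Lambda_seq le_in).
Qed.

Variable q : K.

(* The component of degree n of the series sigma_1^sharp. *)
Definition sigma_sharp (n : nat) : MR :=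
  \sum_(i < n.+1) (- q) ^+ i *: (bar (Lambda i) * Sn (n - i)).

Definition sharp (F : MR) : MR :=
  linext (fun w : word => star << w >> (sigma_sharp (wdeg w))) F.

Definition Qring (F : MR) : Prop := exists G : MR, F = sharp G.

Definition Qmod (F : MR) : Prop :=
  exists (N : nat) (X : nat -> MR),
    (forall n, Qring (X n)) /\ F = \sum_(n < N) Sn n * X n.

Definition is_subspace (P : MR -> Prop) : Prop :=
  P 0 /\ forall (a : K) (F G : MR), P F -> P G -> P (a *: F + G).

(* The unit of the product * on the component of degree n of MR is Sn n. *)
Definition is_star_subalgebra (P : MR -> Prop) : Prop :=
  [/\ is_subspace P, forall n, P (Sn n)
    & forall F G, P F -> P G -> P (star F G)].

Definition is_star_left_ideal (P I : MR -> Prop) : Prop :=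
  [/\ is_subspace I, forall F, I F -> P F
    & forall F G, P F -> I G -> I (star F G)].

End MantaciReutenauer.

(* Main.v *)
From HB Require Import structures.
Require Import Defs.
From mathcomp Require Import all_boot all_order all_algebra.
From mathcomp Require Import finmap monalg.
From mathcomp Require Import fraction complex reals.

Set Implicit Arguments.
Unset Strict Implicit.
Unset Printing Implicit Defensive.

Import GRing.Theory.
Local Open Scope ring_scope.

Local Notation "1" := (@mone _) : monom_scope.
Local Notation "x * y" := (mmul x y) : monom_scope.

(* Sharp is multiplicative and F |-> F * K^sharp is determined through the
   splitting formula by its values on generators, because sigma_1^sharp is
   grouplike: the image Q0 of sharp is thus a subalgebra for the ordinary
   product, a subcoalgebra (Delta (K^sharp) = (sharp (x) sharp) (Delta K)), and
   a left ideal of the whole of MR for *. The splitting formula reduces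
   (S_n F^sharp) * (S_m K^sharp) to the statement that F^sharp * (S_j K^sharp)
   is in Q0, and then to the case where F is a generator.  There,
   (-1)^n Lambda_n * _ is the antipode on the component of degree n, since both
   are inverses of the identity for convolution. As the antipode is an
   antimorphism, the factors coming from S_j regroup in the middle:
     sigma_1^sharp * (S_j K^sharp)
       = sum over (K) of phi(K1^sharp) S_j^sharp K2^sharp,
   where phi is q^deg times the barred antipode. Finally phi(K1^sharp) is in Q0,
   because up to a scalar it is a bar of Lambda_n * K1^sharp. *)

(** * Formal power series over a noncommutative ring *)

(** Substitute [k = i + j]; this regrouping gives both the associativity of [cauchy] and the
    coassociativity of [splits]. *)
Lemma big_triangle (V : nmodType) (g : nat -> nat -> nat -> V) n :
  \sum_(i < n.+1) \sum_(j < (n - i).+1) g i j (n - i - j)%N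
  = \sum_(k < n.+1) \sum_(i < k.+1) g i (k - i)%N (n - k)%N.
Proof.
transitivity
  (\sum_(i < n.+1) \sum_(k < n.+1 | (i <= k)%N) g i (k - i)%N (n - k)%N).
  apply: eq_bigr => i _.
  rewrite -(big_mkord xpredT (fun j => g i j (n - i - j)%N)).
  rewrite -(big_geq_mkord _ _ xpredT (fun k => g i (k - i)%N (n - k)%N)).
  rewrite -[X in _ = \sum_(X <= _ < _) _]add0n big_addn subSn -1?ltnS //.
  by apply: eq_bigr => j _; rewrite addnK addnC subnDA.
rewrite (exchange_big_dep xpredT) //=; apply: eq_bigr => k _.
by rewrite (big_ord_widen _ (fun i => g i (k - i)%N (n - k)%N) (ltn_ord k)).
Qed.

Section CauchyProduct.
Variable A : pzRingType.
Implicit Types a b c : nat -> A.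

(** Sequences encode power series, so that infinite sums such as $\sigma_1$ are handled degree by
    degree. *)
Definition cauchy a b n := \sum_(i < n.+1) a i * b (n - i)%N.

Definition cauchy1 n : A := (n == 0%N)%:R.

Lemma eq_cauchy a a' b b' :
  a =1 a' -> b =1 b' -> cauchy a b =1 cauchy a' b'.
Proof. by move=> aa bb n; apply: eq_bigr => i _; rewrite aa bb. Qed.

Lemma cauchyA a b c : cauchy a (cauchy b c) =1 cauchy (cauchy a b) c.
Proof.
move=> n; rewrite /cauchy.
transitivity
  (\sum_(i < n.+1) \sum_(j < (n - i).+1) a i * b j * c (n - i - j)%N).
  by apply: eq_bigr => i _; rewrite mulr_sumr; apply: eq_bigr => j _;
     rewrite mulrA.
rewrite (big_triangle (fun i j k => a i * b j * c k)).
by apply: eq_bigr => k _; rewrite mulr_suml.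
Qed.

Lemma cauchyC a b :
  (forall i j, GRing.comm (a i) (b j)) -> cauchy a b =1 cauchy b a.
Proof.
move=> ab n; rewrite /cauchy (reindex_inj rev_ord_inj) /=.
by apply: eq_bigr => i _; rewrite subSS subKn -1?ltnS // ab.
Qed.

Lemma cauchy1l a : cauchy cauchy1 a =1 a.
Proof.
move=> n; rewrite /cauchy big_ord_recl big1 ?addr0 => [|i _].
  by rewrite /cauchy1 mul1r subn0.
by rewrite /cauchy1 mul0r.
Qed.

Lemma cauchy1r a : cauchy a cauchy1 =1 a.
Proof.
move=> n; rewrite -[RHS]cauchy1l; apply: cauchyC => i j.
by rewrite /cauchy1 /GRing.comm mulr_natr mulr_natl.
Qed.

(** A product of two monomials; it collapses the sums from the splitting formula in which each
    factor survives in one degree only. *)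
Lemma cauchy_delta (x y : nat) (u v : A) n :
  cauchy (fun i => if i == x then u else 0) (fun j => if j == y then v else 0) n
  = if n == (x + y)%N then u * v else 0.
Proof.
rewrite /cauchy; have [le_xn|lt_nx] := leqP x n; last first.
  rewrite big1 => [|i _]; first by rewrite ltn_eqF // ltn_addr.
  rewrite ltn_eqF ?mul0r //; exact: leq_ltn_trans (ltn_ord i : i <= n)%N lt_nx.
have lt_x : (x < n.+1)%N by [].
rewrite (bigD1 (Ordinal lt_x)) //= eqxx big1 => [|i ne]; last first.
  by rewrite -val_eqE /= in ne; rewrite (negPf ne) mul0r.
rewrite addr0 -(eqn_add2l x) subnKC //.
by case: eqP; rewrite ?mulr0.
Qed.

(** The term of index 0 in coefficient [n] is [b n], and strong induction kills the others: constant
    term 1 makes [a] cancellable on the left. *)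
Lemma cauchy_eq0 a b : a 0%N = 1 -> cauchy a b =1 (fun=> 0) -> b =1 (fun=> 0).
Proof.
move=> a0 ab0 n; elim/ltn_ind: n => n IHn.
have := ab0 n; rewrite /cauchy big_ord_recl subn0 a0 mul1r.
rewrite big1 ?addr0 // => i _.
by rewrite IHn ?mulr0 // ltn_subrL /= (leq_trans _ (ltn_ord i)).
Qed.

(* If [ab = 1] then [a (ba - 1) = 0]. *)
Lemma cauchy_inv a b :
  a 0%N = 1 -> cauchy a b =1 cauchy1 -> cauchy b a =1 cauchy1.
Proof.
move=> a0 ab1 n; apply/eqP; rewrite -subr_eq0; apply/eqP.
move: n; apply: (cauchy_eq0 a0) => n.
rewrite -[RHS](subrr (a n)) -{2}(cauchy1r a n) -(cauchy1l a n).
rewrite -(eq_cauchy ab1 (frefl a)) -cauchyA /cauchy -sumrB.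
by apply: eq_bigr => i _; rewrite mulrBr.
Qed.

Lemma cauchyACA a b c d : (forall i j, GRing.comm (b i) (c j)) ->
  cauchy (cauchy a b) (cauchy c d) =1 cauchy (cauchy a c) (cauchy b d).
Proof.
move=> bc n; rewrite -!cauchyA; apply: eq_cauchy => // {}n.
by rewrite !cauchyA; apply: eq_cauchy => //; apply: cauchyC.
Qed.

End CauchyProduct.

(** * Words, degrees and the coproduct on words *)

Lemma word_ind (P : word -> Prop) :
  P 1%M -> (forall x w, P w -> P (fmu x * w)%M) -> forall w, P w.
Proof.
move=> P1 PM w; rewrite -[w]fmK; elim: (fmonom_val w) => [|x s IHs].
  by rewrite -fmoneE.
suff -> : FMonom (x :: s) = (fmu x * FMonom s)%M by apply: PM.
by apply/eqP; rewrite fmP fmM fmU.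
Qed.

Lemma wdeg1 : wdeg 1%M = 0%N.
Proof. by rewrite /wdeg fm1 big_nil. Qed.

Lemma wdegM u v : wdeg (u * v)%M = (wdeg u + wdeg v)%N.
Proof. by rewrite /wdeg fmM big_cat. Qed.

Lemma wdegU x : wdeg (fmu x) = ldeg x.
Proof. by rewrite /wdeg fmU big_seq1. Qed.

Lemma wdeg_eq0 w : (wdeg w == 0%N) = (w == 1%M).
Proof.
elim/word_ind: w => [|x w _]; first by rewrite wdeg1 !eqxx.
by rewrite wdegM wdegU fmM_eq1 fm1_eq1.
Qed.

Definition Sw (b : bool) (n : nat) : word :=
  if n is m.+1 then fmu (b, m) else 1%M.

Arguments ldeg : simpl never.
Arguments Sw : simpl never.

Lemma Sw_eq1 b n : (Sw b n == 1%M) = (n == 0%N).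
Proof. by case: n => [|n]; rewrite /Sw ?eqxx ?fm1_eq1. Qed.

Lemma wdeg_Sw b n : wdeg (Sw b n) = n.
Proof. by case: n => [|n]; rewrite /Sw ?wdeg1 ?wdegU. Qed.

Lemma Sw_ldeg x : Sw x.1 (ldeg x) = fmu x.
Proof. by case: x. Qed.

(* The coproduct of a word is the sum of the pairs in this list. *)
Definition splits (w : word) : seq (word * word) :=
  foldr (fun x ps =>
      [seq ((Sw x.1 i, Sw x.1 (ldeg x - i)) * p)%M
         | i <- iota 0 (ldeg x).+1, p <- ps])
    [:: 1%M] (w : seq letter).

Lemma pair_mul1m (p : word * word) : ((1, 1) * p)%M = p.
Proof. exact: (@Monoid.mul1m _ _ (@mmul (word * word)%type)). Qed.

Lemma pair_mulm1 (p : word * word) : (p * (1, 1))%M = p.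
Proof. exact: (@Monoid.mulm1 _ _ (@mmul (word * word)%type)). Qed.

Section Splits.
Variable V : nmodType.
Implicit Type h : word * word -> V.

Lemma big_splits1 h : \sum_(p <- splits 1%M) h p = h (1%M, 1%M).
Proof. by rewrite /splits fm1 big_seq1. Qed.

Lemma big_splits_cons h x w :
  \sum_(p <- splits (fmu x * w)%M) h p =
  \sum_(i < (ldeg x).+1) \sum_(p <- splits w)
     h ((Sw x.1 i, Sw x.1 (ldeg x - i)) * p)%M.
Proof.
rewrite {1}/splits fmM fmU [_ ++ _]/= [foldr _ _ _]/foldr -/(splits w).
rewrite big_allpairs_dep -[iota _ _]/(index_iota 0 (ldeg x).+1) big_mkord.
by [].
Qed.

Lemma big_splitsM h u v :
  \sum_(p <- splits (u * v)%M) h p =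
  \sum_(p <- splits u) \sum_(r <- splits v) h (p * r)%M.
Proof.
elim/word_ind: u h => [|x u IHu] h.
  rewrite big_splits1 Monoid.mul1m.
  by apply: eq_bigr => r _; rewrite pair_mul1m.
rewrite -Monoid.mulmA !big_splits_cons; apply: eq_bigr => i _.
rewrite IHu; apply: eq_bigr => p _; apply: eq_bigr => r _.
by rewrite Monoid.mulmA.
Qed.

Lemma big_splits_Sw h b n :
  \sum_(p <- splits (Sw b n)) h p = \sum_(i < n.+1) h (Sw b i, Sw b (n - i)).
Proof.
case: n => [|n]; first by rewrite big_splits1 big_ord1.
have := big_splits_cons h (b, n) 1%M; rewrite Monoid.mulm1 => ->.
apply: eq_bigr => i _.
by rewrite big_splits1 pair_mulm1.
Qed.

(** The leading letter splits into three in two ways matched by [big_triangle]; the rest of the word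
    is the induction hypothesis, with the pieces of the letter absorbed into [h]. *)
Lemma splits_coassoc (h : word -> word -> word -> V) w :
  \sum_(p <- splits w) \sum_(r <- splits p.2) h p.1 r.1 r.2 =
  \sum_(p <- splits w) \sum_(r <- splits p.1) h r.1 r.2 p.2.
Proof.
elim/word_ind: w h => [|x w IHw] h; first by rewrite !big_splits1.
rewrite !big_splits_cons /=.
pose g i j k := \sum_(p <- splits w) \sum_(r <- splits p.2)
  h (Sw x.1 i * p.1)%M (Sw x.1 j * r.1)%M (Sw x.1 k * r.2)%M.
transitivity (\sum_(i < (ldeg x).+1) \sum_(j < (ldeg x - i).+1)
                g i j (ldeg x - i - j)%N).
  apply: eq_bigr => i _; rewrite exchange_big /=; apply: eq_bigr => p _.
  by rewrite big_splitsM big_splits_Sw.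
rewrite big_triangle; apply: eq_bigr => k _; rewrite /g.
transitivity (\sum_(i < k.+1) \sum_(p <- splits w) \sum_(r <- splits p.1)
    h (Sw x.1 i * r.1)%M (Sw x.1 (k - i) * r.2)%M
      (Sw x.1 (ldeg x - k) * p.2)%M).
  apply: eq_bigr => i _; exact: (IHw (fun a b c => h (Sw x.1 i * a)%M
    (Sw x.1 (k - i) * b)%M (Sw x.1 (ldeg x - k) * c)%M)).
rewrite exchange_big; apply: eq_bigr => p _.
by rewrite big_splitsM big_splits_Sw.
Qed.

Lemma splits_counitl (h : word -> V) w :
  \sum_(p <- splits w) h p.2 *+ (p.1 == 1%M) = h w.
Proof.
elim/word_ind: w h => [|x w IHw] h; first by rewrite big_splits1 eqxx.
(* A nonempty piece of the leading letter makes the left part nonempty, so only [i = 0] remains. *)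
rewrite big_splits_cons big_ord_recl [X in _ + X]big1 => [|i _]; last first.
  by rewrite big1 // => p _; rewrite fmM_eq1 Sw_eq1.
rewrite addr0 -(IHw (fun u => h (fmu x * u)%M)); apply: eq_bigr => p _.
by rewrite /= subn0 Sw_ldeg Monoid.mul1m.
Qed.

Lemma splits_counitr (h : word -> V) w :
  \sum_(p <- splits w) h p.1 *+ (p.2 == 1%M) = h w.
Proof.
elim/word_ind: w h => [|x w IHw] h; first by rewrite big_splits1 eqxx.
rewrite big_splits_cons big_ord_recr /= [X in X + _]big1 => [|i _]; last first.
  by rewrite big1 // => p _; rewrite fmM_eq1 Sw_eq1 subn_eq0 leqNgt ltn_ord.
rewrite add0r -(IHw (fun u => h (fmu x * u)%M)); apply: eq_bigr => p _.
by rewrite /= subnn Sw_ldeg Monoid.mul1m.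
Qed.

End Splits.

(** * Linear and bilinear maps on monoid algebras *)

Section Linearity.
Variable K : fieldType.

HB.instance Definition _ (B : choiceType) (A : lalgType K) (f : B -> A) :=
  GRing.isLinear.Build K {malg K[B]} A *:%R (linext f) (linextP f).

Lemma malg_ind (B : choiceType) (P : {malg K[B]} -> Prop) :
  P 0 -> (forall a b F, P F -> P (a *: << b >> + F)) -> forall F, P F.
Proof.
move=> P0 PS F; rewrite [F]monalgE.
elim: (msupp F : seq B) => [|b s IHs]; first by rewrite big_nil.
rewrite big_cons; set c := F@_b.
suff -> : << c *g b >> = c *: << b >> :> {malg K[B]} by apply: PS.
by apply/malgP => u; rewrite mcoeffZ !mcoeffU mulr_natr.
Qed.

(** Linearity is a hypothesis rather than a structure, so that both sides of an identity can be
    plain expressions. *)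
Lemma eq_linear_malg (B : choiceType) (V : lmodType K)
    (f g : {malg K[B]} -> V) :
  linear f -> linear g -> (forall b, f << b >> = g << b >>) -> f =1 g.
Proof.
have lin0 h : linear h -> h 0 = 0 :> V.
  by move=> hl; have := hl (-1) 0 0; rewrite scaler0 addr0 scaleN1r addNr.
move=> fl gl fg; elim/malg_ind => [|a b F IHF]; first by rewrite !lin0.
by rewrite fl gl fg IHF.
Qed.

Lemma eq_bilinear_malg (B1 B2 : choiceType) (V : lmodType K)
    (f g : {malg K[B1]} -> {malg K[B2]} -> V) :
  (forall F, linear (f F)) -> (forall G, linear (f^~ G)) ->
  (forall F, linear (g F)) -> (forall G, linear (g^~ G)) ->
  (forall b1 b2, f << b1 >> << b2 >> = g << b1 >> << b2 >>) ->
  forall F G, f F G = g F G.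
Proof.
move=> fr fl gr gl fg F G; apply: (eq_linear_malg (fl G) (gl G)) => b1.
exact: (eq_linear_malg (fr _) (gr _)).
Qed.

Lemma malgUM (M : monomType) (u v : M) :
  << u >> * << v >> = << (u * v)%M >> :> {malg K[M]}.
Proof. by rewrite malgM_def fgmulUU mulr1. Qed.

Lemma malg_mull_linear (M : monomType) (F : {malg K[M]}) : linear ( *%R F).
Proof. by move=> a G H; rewrite mulrDr malg_scalerAr. Qed.

Lemma malg_mulr_linear (M : monomType) (G : {malg K[M]}) : linear ( *%R^~ G).
Proof. by move=> a F H; rewrite mulrDl scalerAl. Qed.

Section BilinearMaps.
Variables (B1 B2 : choiceType) (A : lalgType K) (f : B1 -> {malg K[B2]} -> A).
Hypothesis f_linear : forall b, linear (f b).

(** [tensor] and [star] extend linearly a family indexed by the words of the left argument;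
    linearity in the right argument comes from each member. *)
Fact bilinext_linear F : linear (fun G => linext (f^~ G) F).
Proof.
move=> a G H; elim/malg_ind: F => [|c b F IHF].
  by rewrite !linear0 addr0.
by rewrite !linearP /= IHF !linextU f_linear scalerDr addrACA.
Qed.
End BilinearMaps.

Fact itcoprod_linear k : linear (@itcoprod K k).
Proof.
case: k => [|k] a G H /=; last by rewrite /coprod /algext !linearP.
by rewrite mcoeffD mcoeffZ scalerDl scalerA.
Qed.
HB.instance Definition _ k := GRing.isLinear.Build K _ _ *:%R (@itcoprod K k)
  (@itcoprod_linear k).

Fact wstar_linear w : linear (@wstar K w).
Proof. by move=> a G H; rewrite /wstar !linearP. Qed.

End Linearity.

(* Sealed copies: on the original definitions, a failing unification unfolds
   both sides down to finitely supported functions. *)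
HB.lock Definition mrbar (K : fieldType) := @bar K.
HB.lock Definition mrtensor (K : fieldType) := @tensor K.
HB.lock Definition mrcoprod (K : fieldType) := @coprod K.
HB.lock Definition mrstar (K : fieldType) := @star K.

(** * Bilinearity of the sealed operations *)

Section SealedOperations.
Variable K : fieldType.
Local Notation MR := {malg K[word]}.
Local Notation MR2 := {malg K[(word * word)%type]}.
Implicit Types F G : MR.

Fact mrbar_linear : linear (@mrbar K).
Proof. by rewrite unlock; apply: (linextP (A := MR)). Qed.
HB.instance Definition _ :=
  GRing.isLinear.Build K MR MR *:%R (@mrbar K) mrbar_linear.

Fact mrcoprod_linear : linear (@mrcoprod K).
Proof. by rewrite unlock; apply: (linextP (A := MR2)). Qed.
HB.instance Definition _ :=
  GRing.isLinear.Build K MR MR2 *:%R (@mrcoprod K) mrcoprod_linear.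

Fact mrtensor_linear F : linear (mrtensor F).
Proof.
by rewrite unlock; apply: bilinext_linear => b a G H; apply: linearP.
Qed.
HB.instance Definition _ F :=
  GRing.isLinear.Build K MR MR2 *:%R (mrtensor F) (mrtensor_linear F).

Fact mrstar_linear F : linear (mrstar F).
Proof. by rewrite unlock; apply: (bilinext_linear (@wstar_linear K)). Qed.
HB.instance Definition _ F :=
  GRing.isLinear.Build K MR MR *:%R (mrstar F) (mrstar_linear F).

Lemma mrtensor_linearl G : linear ((@mrtensor K)^~ G).
Proof. by rewrite unlock => a F H; apply: (linextP (A := MR2)). Qed.

Lemma mrstar_linearl G : linear ((@mrstar K)^~ G).
Proof. by rewrite unlock => a F H; apply: (linextP (A := MR)). Qed.

(** Swapped arguments let linearity in the left factor be registered as well. *)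
Definition mrtensorr G F := mrtensor F G.
HB.instance Definition _ G :=
  GRing.isLinear.Build K MR MR2 *:%R (mrtensorr G) (@mrtensor_linearl G).

Definition mrstarr G F := mrstar F G.
HB.instance Definition _ G :=
  GRing.isLinear.Build K MR MR *:%R (mrstarr G) (@mrstar_linearl G).

Lemma mrtensor_suml I r P (F : I -> MR) G :
  mrtensor (\sum_(i <- r | P i) F i) G = \sum_(i <- r | P i) mrtensor (F i) G.
Proof. exact: (linear_sum (mrtensorr G)). Qed.

Lemma mrstar_suml I r P (F : I -> MR) G :
  mrstar (\sum_(i <- r | P i) F i) G = \sum_(i <- r | P i) mrstar (F i) G.
Proof. exact: (linear_sum (mrstarr G)). Qed.

Lemma mrtensorZl a F G : mrtensor (a *: F) G = a *: mrtensor F G.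
Proof. exact: (linearZZ (mrtensorr G)). Qed.

Lemma mrstarZl a F G : mrstar (a *: F) G = a *: mrstar F G.
Proof. exact: (linearZZ (mrstarr G)). Qed.

Lemma mrstar0l G : mrstar 0 G = 0.
Proof. exact: (linear0 (mrstarr G)). Qed.

Lemma mrbarM F G : mrbar (F * G) = mrbar F * mrbar G.
Proof. by rewrite unlock; apply: barM. Qed.

Lemma mrbarZ a F : mrbar (a *: F) = a *: mrbar F.
Proof. exact: linearZZ. Qed.

Lemma mrbar1 : mrbar 1 = 1 :> MR.
Proof. by rewrite unlock; apply: algext1. Qed.

Lemma mrbar_gen x : mrbar (gen K x) = gen K (lbar x).
Proof. by rewrite unlock; apply: algext_gen. Qed.

Lemma mrcoprodM F G : mrcoprod (F * G) = mrcoprod F * mrcoprod G.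
Proof. by rewrite unlock; apply: coprodM. Qed.

Lemma mrcoprod1 : mrcoprod 1 = 1 :> MR2.
Proof. by rewrite unlock; apply: algext1. Qed.

Lemma mrcoprod_Sb b n :
  mrcoprod (Sb K b n) = \sum_(i < n.+1) mrtensor (Sb K b i) (Sb K b (n - i)).
Proof. by rewrite mrcoprod.unlock mrtensor.unlock; apply: coprod_Sb. Qed.

Lemma mrtensorUU u v : mrtensor << u >> << v >> = << (u, v) >> :> MR2.
Proof. by rewrite unlock; apply: tensorUU. Qed.

Lemma mrstarUE w G : mrstar << w >> G = wstar w G.
Proof. by rewrite unlock; apply: (linextU (A := MR)). Qed.

End SealedOperations.

(** * The splitting formula for arbitrary factors *)

(** This is $\mu\circ(f\otimes g)$, the shape of the right-hand side of the splitting formula for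
    two factors. *)
HB.lock Definition tmul (K : fieldType)
    (f g : {malg K[word]} -> {malg K[word]}) :
    {malg K[(word * word)%type]} -> {malg K[word]} :=
  linext (fun p => f << p.1 >> * g << p.2 >>).

Section Products.
Variable K : fieldType.
Local Notation MR := {malg K[word]}.
Local Notation MR2 := {malg K[(word * word)%type]}.
Implicit Types (f g : MR -> MR) (F G X Y : MR) (u v w : word).

Lemma SbE b n : Sb K b n = << Sw b n >>.
Proof. by case: n. Qed.

Lemma gen_Sb x : gen K x = Sb K x.1 (ldeg x).
Proof. by case: x. Qed.

Lemma mrtensorM F G F' G' :
  mrtensor F G * mrtensor F' G' = mrtensor (F * F') (G * G').
Proof.
have mull := @malg_mull_linear K; have mulr := @malg_mulr_linear K.
move: F F'; apply: eq_bilinear_malg =>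
  [F a H H'|F' a H H'|F a H H'|F' a H H'|u u'].
- by rewrite -mull -mrtensor_linearl.
- by rewrite -mulr -mrtensor_linearl.
- by rewrite /= mull mrtensor_linearl.
- by rewrite /= mulr mrtensor_linearl.
move: G G'; apply: eq_bilinear_malg =>
  [G a H H'|G' a H H'|G a H H'|G' a H H'|v v'].
- by rewrite -mull -mrtensor_linear.
- by rewrite -mulr -mrtensor_linear.
- by rewrite /= mull mrtensor_linear.
- by rewrite /= mulr mrtensor_linear.
by rewrite !malgUM !mrtensorUU malgUM.
Qed.

Lemma mrcoprod_word w : mrcoprod << w >> = \sum_(p <- splits w) << p >> :> MR2.
Proof.
elim/word_ind: w => [|x w IHw].
  by rewrite big_splits1 -[<< _ >>]/(1 : MR) mrcoprod1.
rewrite -malgUM mrcoprodM IHw -/(gen K x) gen_Sb mrcoprod_Sb.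
rewrite big_splits_cons mulr_suml.
apply: eq_bigr => i _; rewrite mulr_sumr; apply: eq_bigr => p _.
by rewrite !SbE mrtensorUU malgUM.
Qed.

Lemma wstar1 G : wstar 1%M G = (G@_1%M)%:A.
Proof.
rewrite /wstar fm1 /= linearZ_LR /=; congr (_ *: _); rewrite linextU.
by rewrite fm1 big_nil.
Qed.

Lemma wstar_cons x w u :
  wstar (fmu x * w)%M << u >> =
    \sum_(p <- splits u) genstar K x p.1 * wstar w << p.2 >>.
Proof.
rewrite /wstar fmM fmU /= -[coprod]/(fun K => @coprod K).
rewrite -mrcoprod.unlock mrcoprod_word.
rewrite (linear_sum (linext (fun p =>
  << fmu p.1 >> * itcoprod (size w) << p.2 >>))).
rewrite (linear_sum (linext _)) /=; apply: eq_bigr => p _.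
rewrite linextU; move: (itcoprod _ _).
apply: eq_linear_malg => [a F H|a F H|t].
- by rewrite mulrDr -malg_scalerAr linearP.
- by rewrite linearP /= mulrDr malg_scalerAr.
by rewrite malgUM !linextU fmM fmU big_cons.
Qed.

(** By induction on [w]: the empty word acts as the counit, and coassociativity hands the first
    letter its own part of [u]. *)
Lemma wstarM w w' u :
  wstar (w * w')%M << u >> =
    \sum_(p <- splits u) wstar w << p.1 >> * wstar w' << p.2 >> :> MR.
Proof.
elim/word_ind: w u => [|x w IHw] u.
  rewrite Monoid.mul1m -[LHS](splits_counitl (fun u => wstar w' << u >>)).
  apply: eq_bigr => p _; rewrite wstar1 mcoeffU1.
  by case: eqP => _; rewrite ?scale1r ?mul1r // scale0r mul0r.
rewrite -Monoid.mulmA wstar_cons.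
transitivity (\sum_(p <- splits u) \sum_(r <- splits p.2)
    genstar K x p.1 * (wstar w << r.1 >> * wstar w' << r.2 >>)).
  by apply: eq_bigr => p _; rewrite IHw mulr_sumr.
rewrite (splits_coassoc (fun a b c =>
  genstar K x a * (wstar w << b >> * wstar w' << c >>))).
apply: eq_bigr => p _; rewrite wstar_cons mulr_suml.
by apply: eq_bigr => r _; rewrite mulrA.
Qed.

Lemma tmulUE f g p : tmul f g << p >> = f << p.1 >> * g << p.2 >>.
Proof. by rewrite tmul.unlock; apply: (linextU (A := MR)). Qed.

Fact tmul_linear f g : linear (tmul f g).
Proof. by rewrite tmul.unlock; apply: (linextP (A := MR)). Qed.
HB.instance Definition _ f g :=
  GRing.isLinear.Build K MR2 MR *:%R (tmul f g) (tmul_linear f g).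

Lemma tmul_tensor (f g : {linear MR -> MR}) X Y :
  tmul f g (mrtensor X Y) = f X * g Y.
Proof.
have mull := @malg_mull_linear K; have mulr := @malg_mulr_linear K.
move: X Y; apply: eq_bilinear_malg =>
  [F a H H'|F' a H H'|F a H H'|F' a H H'|u u'].
- by rewrite mrtensor_linear linearP.
- by rewrite mrtensor_linearl linearP.
- by rewrite linearP mull.
- by rewrite linearP mulr.
by rewrite mrtensorUU tmulUE.
Qed.

(** Bilinearity removes the restriction to words, so the two factors are arbitrary. *)
Lemma mrstar_splits F1 F2 u :
  mrstar (F1 * F2) << u >> =
    \sum_(p <- splits u) mrstar F1 << p.1 >> * mrstar F2 << p.2 >>.
Proof.
have mull := @malg_mull_linear K; have mulr := @malg_mulr_linear K.
move: F1 F2; apply: eq_bilinear_malg =>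
  [F a H H'|F' a H H'|F a H H'|F' a H H'|w w'].
- by rewrite mull mrstar_linearl.
- by rewrite mulr mrstar_linearl.
- rewrite scaler_sumr -big_split; apply: eq_bigr => p _.
  by rewrite mrstar_linearl mull.
- rewrite scaler_sumr -big_split; apply: eq_bigr => p _.
  by rewrite mrstar_linearl mulr.
by rewrite malgUM mrstarUE wstarM; apply: eq_bigr => p _; rewrite !mrstarUE.
Qed.

Lemma mrstar_mul F1 F2 G :
  mrstar (F1 * F2) G = tmul (mrstar F1) (mrstar F2) (mrcoprod G).
Proof.
move: G; apply: eq_linear_malg => [a F H|a F H|u]; rewrite ?linearP //.
rewrite mrstar_splits mrcoprod_word (linear_sum (tmul _ _)).
by apply: eq_bigr => p _; rewrite /= tmulUE.
Qed.

Lemma mrstar1 G : mrstar 1 G = (G@_1%M)%:A.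
Proof. by rewrite mrstarUE wstar1. Qed.

End Products.

(** * Grading and the action of generators *)

HB.lock Definition proj (K : fieldType) (n : nat) :
    {malg K[word]} -> {malg K[word]} :=
  linext (fun u => if wdeg u == n then << u >> else 0).

Section Grading.
Variable K : fieldType.
Local Notation MR := {malg K[word]}.
Local Notation MR2 := {malg K[(word * word)%type]}.
Implicit Types (F G X Y : MR) (u v w : word).

Lemma malgU1 (M : monomType) : << 1%M >> = 1 :> {malg K[M]}.
Proof. by []. Qed.

Lemma gen_word x w : << (fmu x * w)%M >> = gen K x * << w >>.
Proof. by rewrite malgUM. Qed.

Lemma mrbarK : involutive (@mrbar K).
Proof.
apply: eq_linear_malg => [a F G|a F G|w]; rewrite ?linearP //.
elim/word_ind: w => [|x w IHw]; first by rewrite malgU1 mrbar1 mrbar1.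
by rewrite gen_word !mrbarM IHw !mrbar_gen /lbar /= negbK; case: x.
Qed.

Lemma projU n u : proj n << u >> = if wdeg u == n then << u >> else 0 :> MR.
Proof. by rewrite proj.unlock; apply: (linextU (A := MR)). Qed.

Fact proj_linear n : linear (@proj K n).
Proof. by rewrite proj.unlock; apply: (linextP (A := MR)). Qed.
HB.instance Definition _ n :=
  GRing.isLinear.Build K MR MR *:%R (@proj K n) (proj_linear n).

(** Being fixed by the projector turns homogeneity into a linear condition; 0 is homogeneous of
    every degree. *)
Definition homog n F := proj n F = F.

Lemma proj_homog m n F : homog n F -> proj m F = if n == m then F else 0.
Proof.
move=> <-; move: F; apply: eq_linear_malg => [a F G|a F G|u].
- by rewrite !linearP.
- by case: ifP; rewrite ?linearP ?scaler0 ?addr0.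
rewrite !projU; case: (wdeg u =P n) => [<-|_]; last by rewrite linear0 if_same.
exact: projU.
Qed.

Lemma homogU w : homog (wdeg w) << w >>.
Proof. by rewrite /homog projU eqxx. Qed.

Lemma homog1 : homog 0 1.
Proof. by rewrite -wdeg1; apply: homogU. Qed.

Lemma homog_Sb b n : homog n (Sb K b n).
Proof. by rewrite SbE -{1}(wdeg_Sw b n); apply: homogU. Qed.

Lemma homogZ n a F : homog n F -> homog n (a *: F).
Proof. by rewrite /homog linearZ /= => ->. Qed.

Lemma homog_sum n I r (P : pred I) (F : I -> MR) :
  (forall i, P i -> homog n (F i)) -> homog n (\sum_(i <- r | P i) F i).
Proof. by move=> hF; rewrite /homog linear_sum; apply: eq_bigr. Qed.

Lemma homogM m n F G : homog m F -> homog n G -> homog (m + n) (F * G).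
Proof.
rewrite /homog => <- <-; move: F G.
have mull := @malg_mull_linear K; have mulr := @malg_mulr_linear K.
apply: eq_bilinear_malg =>
  [F a H H'|F' a H H'|F a H H'|F' a H H'|u v].
- by rewrite !linearP mull linearP.
- by rewrite !linearP mulr linearP.
- by rewrite linearP mull.
- by rewrite linearP mulr.
rewrite !projU; case: eqP => [<-|]; last by rewrite mul0r linear0.
case: eqP => [<-|]; last by rewrite mulr0 linear0.
by rewrite malgUM projU wdegM eqxx.
Qed.

Lemma proj_mrbar n F : proj n (mrbar F) = mrbar (proj n F).
Proof.
move: F; apply: eq_linear_malg => [a F G|a F G|u]; rewrite ?linearP //.
have hu : homog (wdeg u) (mrbar << u >> : MR).
  elim/word_ind: u => [|x u IHu]; first by rewrite mrbar1 wdeg1; apply: homog1.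
  rewrite gen_word mrbarM wdegM wdegU mrbar_gen; apply: homogM => //.
  by have := homogU (fmu (lbar x)); rewrite wdegU -[ldeg (lbar x)]/(ldeg x).
by rewrite (proj_homog n hu) projU; case: ifP; rewrite ?linear0.
Qed.

Lemma homog_mrbar n F : homog n F -> homog n (mrbar F).
Proof. by rewrite /homog proj_mrbar => ->. Qed.

(** For one letter, the only splittings of [u] that contribute have an empty right part. The case
    [n = 0] is separate because [Sb b 0] is 1, which acts as the counit. *)
Lemma mrstar_Sb b n G :
  mrstar (Sb K b n) G = if b then mrbar (proj n G) else proj n G.
Proof.
move: G; apply: eq_linear_malg => [a F G|a F G|u].
- exact: linearP.
- by case: b; rewrite !linearP.
case: n => [|n].
  rewrite mrstar1 mcoeffU1 projU wdeg_eq0.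
  by case: eqP => [->|_]; case: b; rewrite ?scale1r ?scale0r ?mrbar1 ?linear0.
rewrite /= mrstarUE -[fmu _](@Monoid.mulm1 _ _ (@mmul word)) wstar_cons.
transitivity (\sum_(p <- splits u) genstar K (b, n) p.1 *+ (p.2 == 1%M)).
  apply: eq_bigr => p _; rewrite wstar1 mcoeffU1.
  by case: eqP; rewrite ?scale1r ?mulr1 // scale0r mulr0.
rewrite (splits_counitr (genstar K (b, n))) /genstar projU eq_sym.
by case: eqP; case: b => // _; rewrite ?linear0 // mrbar.unlock.
Qed.

(** By the splitting formula it suffices to look at letters, where barring a letter bars its result;
    [mrbar] is an involution and multiplicative. *)
Lemma mrstar_mrbar F G : mrstar (mrbar F) G = mrbar (mrstar F G).
Proof.
move: F G; apply: eq_bilinear_malg => [F a H H'|G a H H'|F a H H'|G a H H'|w u].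
- exact: linearP.
- by rewrite linearP mrstar_linearl.
- by rewrite !linearP.
- by rewrite mrstar_linearl linearP.
elim/word_ind: w u => [|x w IHw] u.
  by rewrite mrbar1 mrstar1 linearZ /= mrbar1.
rewrite gen_word mrbarM 2!mrstar_splits.
rewrite (linear_sum (@mrbar K)); apply: eq_bigr => p _ /=.
rewrite IHw mrbarM mrbar_gen 2!gen_Sb 2!mrstar_Sb /=.
by case: x.1; rewrite /= ?mrbarK.
Qed.

Lemma splits_wdeg w p : p \in splits w -> (wdeg p.1 + wdeg p.2)%N = wdeg w.
Proof.
elim/word_ind: w p => [|x w IHw] p.
  by rewrite /splits fm1 inE => /eqP ->; rewrite wdeg1.
rewrite {1}/splits fmM fmU [_ ++ _]/= [foldr _ _ _]/foldr -/(splits w).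
case/allpairsPdep => i [r [+ /IHw hr ->]].
rewrite mem_iota add0n => /andP[_ hi].
by rewrite !wdegM !wdeg_Sw wdegU -hr addnACA subnKC.
Qed.

(** Both sides keep only the pairs of words of degree [n], since words of different degrees have
    product 0. *)
Lemma mrstar_proj n F G : mrstar F (proj n G) = mrstar (proj n F) G.
Proof.
have star0 w u : wdeg w != wdeg u -> mrstar << w >> << u >> = 0 :> MR.
  elim/word_ind: w u => [|x w IHw] u ne.
    by rewrite mrstar1 mcoeffU1 -wdeg_eq0 -wdeg1 eq_sym (negPf ne) scale0r.
  rewrite gen_word mrstar_splits big_seq big1 // => p /splits_wdeg hp.
  (* When the tail matches [p.2] in degree, the letter cannot match [p.1], and its projection
     vanishes. *)
  have [e|/IHw ->] := eqVneq (wdeg w) (wdeg p.2); last by rewrite mulr0.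
  rewrite gen_Sb mrstar_Sb projU; case: eqP => [e'|_]; last first.
    by rewrite linear0 if_same mul0r.
  by case/eqP: ne; rewrite wdegM wdegU -hp e e'.
move: F G; apply: eq_bilinear_malg => [F a H H'|G a H H'|F a H H'|G a H H'|w u].
- by rewrite !linearP.
- by rewrite mrstar_linearl.
- by rewrite !linearP.
- by rewrite linearP mrstar_linearl.
rewrite !projU; have [->|ne] := eqVneq (wdeg w) (wdeg u).
  by case: (_ == n); rewrite ?linear0 ?mrstar0l.
by case: (_ == n); case: (_ == n); rewrite ?linear0 ?mrstar0l ?star0.
Qed.

End Grading.

(** * Grouplike series *)

(** The sign is absorbed so that these are the coefficients of the inverse of $\sigma_1$, or of
    $\bar\sigma_1$ if [b] holds. *)
Definition lam (K : fieldType) (b : bool) (n : nat) : {malg K[word]} :=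
  (-1) ^+ n *: (if b then mrbar (Lambda K n) else Lambda K n).

Section Grouplike.
Variable K : fieldType.
Local Notation MR := {malg K[word]}.
Local Notation MR2 := {malg K[(word * word)%type]}.
Implicit Types (F G : MR) (X Y : nat -> MR).

Lemma mrtensor11 : mrtensor 1 1 = 1 :> MR2.
Proof.
by rewrite -[X in mrtensor X _]malgU1 -[X in mrtensor _ X]malgU1 mrtensorUU.
Qed.

Definition tensorl X n : MR2 := mrtensor (X n) 1.
Definition tensorr X n : MR2 := mrtensor 1 (X n).

(** The condition $\Delta X=X\otimes X$ is written $\Delta X=(X\otimes 1)(1\otimes X)$, a Cauchy
    product in the tensor square. *)
Definition grouplike X := @mrcoprod K \o X =1 cauchy (tensorl X) (tensorr X).

Lemma cauchy_tensor X Y n :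
  cauchy (tensorl X) (tensorr Y) n =
    \sum_(i < n.+1) mrtensor (X i) (Y (n - i)%N).
Proof. by apply: eq_bigr => i _; rewrite mrtensorM mul1r mulr1. Qed.

Lemma tensorlr_comm X Y i j : GRing.comm (tensorl X i) (tensorr Y j).
Proof. by rewrite /GRing.comm /tensorl /tensorr !mrtensorM !mul1r !mulr1. Qed.

Lemma cauchy_tensorl X Y : cauchy (tensorl X) (tensorl Y) =1
  tensorl (cauchy X Y).
Proof.
move=> n; rewrite /tensorl mrtensor_suml; apply: eq_bigr => i _.
by rewrite mrtensorM mulr1.
Qed.

Lemma cauchy_tensorr X Y : cauchy (tensorr X) (tensorr Y) =1
  tensorr (cauchy X Y).
Proof.
move=> n; rewrite /tensorr (linear_sum (mrtensor 1)); apply: eq_bigr => i _.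
by rewrite mrtensorM mulr1.
Qed.

Lemma mrcoprod_cauchy X Y :
  @mrcoprod K \o cauchy X Y =1 cauchy (@mrcoprod K \o X) (@mrcoprod K \o Y).
Proof.
move=> n; rewrite /= (linear_sum (@mrcoprod K)); apply: eq_bigr => i _.
by rewrite /= mrcoprodM.
Qed.

(** $1\otimes X$ commutes with $Y\otimes 1$, so the middle factors of the product of coproducts can
    be exchanged. *)
Lemma grouplikeM X Y : grouplike X -> grouplike Y -> grouplike (cauchy X Y).
Proof.
move=> gX gY n; rewrite mrcoprod_cauchy (eq_cauchy gX gY) cauchyACA; last first.
  by move=> i j; apply: commr_sym; apply: tensorlr_comm.
by apply: eq_cauchy; [apply: cauchy_tensorl | apply: cauchy_tensorr].
Qed.

Lemma grouplikeZ a X : grouplike X -> grouplike (fun n => a ^+ n *: X n).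
Proof.
move=> gX n; rewrite /= linearZ /= [mrcoprod _]gX !cauchy_tensor scaler_sumr.
apply: eq_bigr => i _; rewrite mrtensorZl linearZ scalerA -exprD subnKC //.
by rewrite -ltnS.
Qed.

Lemma tensorl1 : tensorl (@cauchy1 MR) =1 @cauchy1 MR2.
Proof.
move=> [|n]; rewrite /tensorl /cauchy1 /= ?mrtensor11 //.
exact: (linear0 (mrtensorr _)).
Qed.

Lemma tensorr1 : tensorr (@cauchy1 MR) =1 @cauchy1 MR2.
Proof.
by move=> [|n]; rewrite /tensorr /cauchy1 /= ?mrtensor11 // linear0.
Qed.

(** The coproduct being a morphism, $\Delta Y$ is a left inverse of $\Delta X$, and [Z], obtained by
    inverting the factors in reverse order, is a right inverse; so they coincide, and the factors of
    [Z] commute. *)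
Lemma grouplikeV X Y :
  cauchy X Y =1 @cauchy1 MR -> cauchy Y X =1 @cauchy1 MR ->
  grouplike X -> grouplike Y.
Proof.
move=> XY YX gX n.
pose Z := cauchy (tensorr Y) (tensorl Y).
have XZ : cauchy (@mrcoprod K \o X) Z =1 @cauchy1 MR2.
  move=> m; rewrite (eq_cauchy gX (frefl Z)) -cauchyA.
  have e : cauchy (tensorr X) Z =1 tensorl Y.
    move=> k; rewrite cauchyA (eq_cauchy (cauchy_tensorr _ _) (frefl _)).
    rewrite -[RHS]cauchy1l; apply: eq_cauchy => // i.
    by rewrite -tensorr1 /tensorr XY.
  rewrite (eq_cauchy (frefl _) e) cauchy_tensorl.
  by rewrite -tensorl1 /tensorl XY.
have YX' : cauchy (@mrcoprod K \o Y) (@mrcoprod K \o X) =1 @cauchy1 MR2.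
  move=> m; rewrite -mrcoprod_cauchy /= YX /cauchy1.
  by case: (m == 0%N); rewrite ?mrcoprod1 ?linear0.
rewrite -[LHS]cauchy1r -(eq_cauchy (frefl _) XZ) cauchyA.
rewrite (eq_cauchy YX' (frefl _)) cauchy1l.
by apply: cauchyC => i j; apply: commr_sym; apply: tensorlr_comm.
Qed.

Lemma grouplike_Sb b : grouplike (Sb K b).
Proof. by move=> n; rewrite /= mrcoprod_Sb cauchy_tensor. Qed.

Lemma lam0 b : lam K b 0 = 1.
Proof. by rewrite /lam scale1r Lambda0; case: b; rewrite ?mrbar1. Qed.

Lemma lam_Sb b : cauchy (lam K b) (Sb K b) =1 @cauchy1 MR.
Proof.
case=> [|n]; first by rewrite /cauchy big_ord1 lam0 mul1r.
rewrite -[RHS]/0.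
have e := @Lambda_rel K n.+1 isT.
case: b; last first.
  by rewrite -[RHS]e; apply: eq_bigr => i _; rewrite -scalerAl.
have := congr1 (@mrbar K) e; rewrite linear0 => <-.
rewrite (linear_sum (@mrbar K)).
apply: eq_bigr => i _; rewrite /= linearZ /= mrbarM -scalerAl.
by congr (_ *: (_ * _)); rewrite mrbar.unlock bar_Sb.
Qed.

Lemma Sb_lam b : cauchy (Sb K b) (lam K b) =1 @cauchy1 MR.
Proof. exact: (cauchy_inv (lam0 b) (lam_Sb b)). Qed.

Lemma grouplike_lam b : grouplike (lam K b).
Proof. exact: (grouplikeV (@Sb_lam b) (@lam_Sb b) (@grouplike_Sb b)). Qed.

Lemma homog_cauchy X Y n :
  (forall i, homog i (X i)) -> (forall i, homog i (Y i)) ->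
  homog n (cauchy X Y n).
Proof.
move=> hX hY; apply: homog_sum => i _.
by rewrite -[X in homog X _](@subnKC i) -1?ltnS //; apply: homogM.
Qed.

(** Strong induction, solving the defining relation for its last term, where $S_0=1$. *)
Lemma homog_Lambda n : homog n (Lambda K n).
Proof.
elim/ltn_ind: n => -[|n] IHn; first exact: homog1.
have := Lambda_rel K (ltn0Sn n); rewrite big_ord_recr /= subnn mulr1.
move/eqP; rewrite addrC addr_eq0 => /eqP e.
have -> : Lambda K n.+1 =
    - ((-1) ^+ n.+1 *:
       \sum_(i < n.+1) (-1) ^+ i *: (Lambda K i * Sn K (n.+1 - i))).
  by rewrite -scalerN -e scalerA -exprD addnn -signr_odd odd_double scale1r.
rewrite -scaleN1r; apply/homogZ/homogZ/homog_sum => i _; apply: homogZ.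
have le_in : (i <= n.+1)%N by rewrite ltnW.
by rewrite -{1}(subnKC le_in); apply: homogM; [apply: IHn | apply: homog_Sb].
Qed.

Lemma homog_lam b n : homog n (lam K b n).
Proof.
by apply: homogZ; case: b; [apply: homog_mrbar|]; apply: homog_Lambda.
Qed.

End Grouplike.

(** * The antipode *)

(** The antimorphism sending $S_n$ to $(-1)^n\Lambda_n$, and likewise with bars, hence the reversed
    word. *)
HB.lock Definition antipode (K : fieldType) :
    {malg K[word]} -> {malg K[word]} :=
  linext (fun w : word => \prod_(x <- rev (w : seq letter)) lam K x.1 (ldeg x)).

HB.lock Definition mrsharp (K : fieldType) (q : K) := @sharp K q.

Section Antipode.
Variable K : fieldType.
Local Notation MR := {malg K[word]}.
Local Notation MR2 := {malg K[(word * word)%type]}.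
Implicit Types (F G : MR) (X Y : nat -> MR).

Fact antipode_linear : linear (@antipode K).
Proof. by rewrite antipode.unlock; apply: (linextP (A := MR)). Qed.
HB.instance Definition _ :=
  GRing.isLinear.Build K MR MR *:%R (@antipode K) antipode_linear.

Lemma antipodeUE w :
  antipode << w >> = \prod_(x <- rev (w : seq letter)) lam K x.1 (ldeg x).
Proof. by rewrite antipode.unlock; apply: (linextU (A := MR)). Qed.

Lemma antipodeM F G : antipode (F * G) = antipode G * antipode F.
Proof.
have mull := @malg_mull_linear K; have mulr := @malg_mulr_linear K.
move: F G; apply: eq_bilinear_malg => [F a H H'|G a H H'|F a H H'|G a H H'|u v].
- by rewrite mull linearP.
- by rewrite mulr linearP.
- by rewrite linearP mulr.
- by rewrite linearP mull.
by rewrite malgUM !antipodeUE fmM rev_cat big_cat.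
Qed.

Lemma antipode1 : antipode 1 = 1 :> MR.
Proof. by rewrite -malgU1 antipodeUE fm1 big_nil. Qed.

Lemma antipode_Sb b n : antipode (Sb K b n) = lam K b n.
Proof.
case: n => [|n]; first by rewrite antipode1 lam0.
by rewrite SbE antipodeUE fmU big_seq1.
Qed.

(** Reversal nests the sums: the inner one, over the tail, is a counit by induction, and the outer
    one is then $\sigma_1\sigma_1^{-1}$ or its bar in degree [ldeg x]. *)
Lemma id_antipode w :
  \sum_(p <- splits w) << p.1 >> * antipode << p.2 >> = (w == 1%M)%:R :> MR.
Proof.
elim/word_ind: w => [|x w IHw].
  by rewrite big_splits1 malgU1 antipode1 mulr1 eqxx.
rewrite big_splits_cons.
transitivity (\sum_(i < (ldeg x).+1)
    Sb K x.1 i * (w == 1%M)%:R * lam K x.1 (ldeg x - i)).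
  apply: eq_bigr => i _; rewrite -IHw mulr_sumr mulr_suml.
  apply: eq_bigr => p _.
  by rewrite -!malgUM antipodeM -!SbE antipode_Sb !mulrA.
rewrite fmM_eq1 fm1_eq1; case: (w == 1%M); last first.
  by rewrite big1 // => i _; rewrite mulr0 mul0r.
transitivity (cauchy (Sb K x.1) (lam K x.1) (ldeg x)).
  by apply: eq_bigr => i _; rewrite mulr1.
by rewrite Sb_lam.
Qed.

Lemma mrstar_homog n F G : homog n F -> mrstar F G = mrstar F (proj n G).
Proof. by rewrite mrstar_proj => ->. Qed.

(** The splitting formula applied to $\sigma_1^{-1}\sigma_1=1$, acting on [w]. *)
Lemma lam_id w :
  \sum_(p <- splits w) mrstar (lam K false (wdeg p.1)) << p.1 >> * << p.2 >>
  = (w == 1%M)%:R :> MR.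
Proof.
set n := wdeg w.
transitivity (mrstar (cauchy (lam K false) (Sb K false) n) << w >>).
  rewrite /cauchy mrstar_suml.
  under [RHS]eq_bigr do rewrite mrstar_splits.
  rewrite exchange_big /=; apply: eq_big_seq => p /splits_wdeg hp.
  have lt_n : (wdeg p.1 < n.+1)%N by rewrite ltnS /n -hp leq_addr.
  (* Degrees leave only the index [i = wdeg p.1]. *)
  rewrite (bigD1 (Ordinal lt_n)) //= [X in _ + X]big1 => [|i ne].
    by rewrite mrstar_Sb projU /n -hp addKn eqxx addr0.
  rewrite (mrstar_homog _ (homog_lam K false i)) projU.
  case: eqP => [e|_]; last by rewrite linear0 mul0r.
  by case/eqP: ne; apply: val_inj.
rewrite lam_Sb /cauchy1 /n wdeg_eq0; case: eqP => [->|_]; last exact: mrstar0l.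
by rewrite mrstar1 mcoeffU1 eqxx scale1r.
Qed.

(* Both sides are convolution inverses of the identity. *)
Lemma mrstar_lamU w : mrstar (lam K false (wdeg w)) << w >> = antipode << w >>.
Proof.
pose L u : MR := mrstar (lam K false (wdeg u)) << u >>.
rewrite -/(L w) -[LHS](splits_counitr L).
(* For convolution, [L] is [L] times the unit, written as identity times antipode; coassociativity
   regroups this so that [lam_id] leaves the antipode. *)
transitivity (\sum_(p <- splits w) \sum_(r <- splits p.2)
    L p.1 * << r.1 >> * antipode << r.2 >>).
  apply: eq_bigr => p _; rewrite -mulr_natr -id_antipode mulr_sumr.
  by apply: eq_bigr => r _; rewrite mulrA.
rewrite (splits_coassoc (fun a b c => L a * << b >> * antipode << c >>)).
rewrite -[RHS](splits_counitl (fun u => antipode << u >>)).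
apply: eq_bigr => p _; rewrite -mulr_suml lam_id.
by rewrite mulr_natl.
Qed.

Lemma mrstar_lam n G : mrstar (lam K false n) G = antipode (proj n G).
Proof.
rewrite (mrstar_homog _ (homog_lam K false n)).
move: G; apply: eq_linear_malg => [a F G|a F G|w].
- by rewrite !linearP.
- by rewrite !linearP.
rewrite projU; case: eqP => [<-|_]; last by rewrite !linear0.
exact: mrstar_lamU.
Qed.

End Antipode.

(** * The sharp transform *)

Section Sharp.
Variables (K : fieldType) (q : K).
Local Notation MR := {malg K[word]}.
Local Notation MR2 := {malg K[(word * word)%type]}.
Implicit Types (F G : MR) (X Y : nat -> MR).

(** [sigmab false] is $\sigma_1^\sharp$ and [sigmab true] its bar; the sign of $(-q)^n$ sits in
    [lam]. *)
Definition sigmab b : nat -> MR :=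
  cauchy (fun n => q ^+ n *: lam K (~~ b) n) (Sb K b).

Lemma sigma_sharpE n : sigma_sharp q n = sigmab false n.
Proof.
apply: eq_bigr => i _; rewrite /lam mrbar.unlock scalerA -exprMn mulrN1.
by rewrite -scalerAl.
Qed.

Lemma mrbar_sigmab b n : mrbar (sigmab b n) = sigmab (~~ b) n.
Proof.
rewrite (linear_sum (@mrbar K)); apply: eq_bigr => i _.
rewrite [LHS]/= mrbarM /lam 2!mrbarZ.
have -> : mrbar (Sb K b (n - i)) = Sb K (~~ b) (n - i).
  by rewrite mrbar.unlock bar_Sb.
by case: b; rewrite /= ?mrbarK.
Qed.

Lemma grouplike_sigmab b : grouplike (sigmab b).
Proof.
by apply: grouplikeM (@grouplike_Sb K b); apply/grouplikeZ/grouplike_lam.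
Qed.

Lemma homog_sigmab b n : homog n (sigmab b n).
Proof.
apply: homog_cauchy => i; last exact: homog_Sb.
by apply: homogZ; apply: homog_lam.
Qed.

Lemma sigmab0 b : sigmab b 0 = 1.
Proof. by rewrite /sigmab /cauchy big_ord1 lam0 expr0 scale1r mulr1. Qed.

Fact mrsharp_linear : linear (@mrsharp K q).
Proof. by rewrite mrsharp.unlock; apply: (linextP (A := MR)). Qed.
HB.instance Definition _ :=
  GRing.isLinear.Build K MR MR *:%R (@mrsharp K q) mrsharp_linear.

Lemma mrsharpU w : mrsharp q << w >> = mrstar << w >> (sigmab false (wdeg w)).
Proof.
rewrite mrsharp.unlock mrstar.unlock -sigma_sharpE.
exact: (linextU (A := MR)).
Qed.

Lemma mrstar_mul_tensor I (r : seq I) (X Y : I -> MR) F1 F2 G :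
  mrcoprod G = \sum_(i <- r) mrtensor (X i) (Y i) ->
  mrstar (F1 * F2) G = \sum_(i <- r) mrstar F1 (X i) * mrstar F2 (Y i).
Proof.
move=> e; rewrite mrstar_mul e (linear_sum (tmul _ _)).
by apply: eq_bigr => i _; rewrite /= tmul_tensor.
Qed.

Lemma mrcoprod_sigmab b n : mrcoprod (sigmab b n) =
  \sum_(i < n.+1) mrtensor (sigmab b i) (sigmab b (n - i)).
Proof. by have := @grouplike_sigmab b n; rewrite cauchy_tensor. Qed.

(** As $\sigma_1^\sharp$ is grouplike, the splitting formula acts letter by letter. The degree [n]
    is left free because the induction meets the tail in every degree [n - i]. *)
Lemma mrstar_sigmab w n : mrstar << w >> (sigmab false n) =
  if n == wdeg w then \prod_(x <- (w : seq letter)) sigmab x.1 (ldeg x) else 0.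
Proof.
elim/word_ind: w n => [|x w IHw] n.
  rewrite malgU1 -[X in mrstar X _]/(Sb K false 0) mrstar_Sb wdeg1 fm1 big_nil.
  rewrite (proj_homog _ (homog_sigmab false n)).
  by case: eqP => // ->; rewrite sigmab0.
rewrite gen_word (mrstar_mul_tensor _ _ (mrcoprod_sigmab false n)).
rewrite wdegM wdegU fmM fmU big_cons.
have star_x i : mrstar (gen K x) (sigmab false i) =
    if i == ldeg x then sigmab x.1 (ldeg x) else 0.
  rewrite gen_Sb mrstar_Sb (proj_homog _ (homog_sigmab false i)).
  case: eqP => [->|_]; last by rewrite linear0 if_same.
  by rewrite mrbar_sigmab; case: x.1.
rewrite -cauchy_delta; apply: eq_bigr => i _.
by rewrite star_x IHw.
Qed.

Lemma mrsharp_word w :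
  mrsharp q << w >> = \prod_(x <- (w : seq letter)) sigmab x.1 (ldeg x).
Proof. by rewrite mrsharpU mrstar_sigmab eqxx. Qed.

Lemma mrsharp1 : mrsharp q 1 = 1.
Proof. by rewrite -malgU1 mrsharp_word fm1 big_nil. Qed.

Lemma mrsharpM F G : mrsharp q (F * G) = mrsharp q F * mrsharp q G.
Proof.
have mull := @malg_mull_linear K; have mulr := @malg_mulr_linear K.
move: F G; apply: eq_bilinear_malg => [F a H H'|G a H H'|F a H H'|G a H H'|u v].
- by rewrite mull linearP.
- by rewrite mulr linearP.
- by rewrite linearP mull.
- by rewrite linearP mulr.
by rewrite malgUM !mrsharp_word fmM big_cat.
Qed.

Lemma mrsharp_Sb b n : mrsharp q (Sb K b n) = sigmab b n.
Proof.
case: n => [|n]; first by rewrite mrsharp1 sigmab0.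
by rewrite SbE mrsharp_word fmU big_seq1.
Qed.

Lemma mrsharp_mrbar F : mrsharp q (mrbar F) = mrbar (mrsharp q F).
Proof.
move: F; apply: eq_linear_malg => [a F G|a F G|w]; rewrite ?linearP //.
elim/word_ind: w => [|x w IHw]; first by rewrite malgU1 mrbar1 mrsharp1 mrbar1.
rewrite gen_word mrbarM mrsharpM IHw mrsharpM mrbarM mrbar_gen; congr (_ * _).
by rewrite !gen_Sb !mrsharp_Sb mrbar_sigmab.
Qed.

Lemma homog_mrsharp w : homog (wdeg w) (mrsharp q << w >>).
Proof.
elim/word_ind: w => [|x w IHw].
  by rewrite malgU1 mrsharp1 wdeg1; apply: homog1.
rewrite gen_word mrsharpM wdegM wdegU; apply: homogM => //.
by rewrite gen_Sb mrsharp_Sb; apply: homog_sigmab.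
Qed.

(** [mrsharp q] sends [Sb b] to [sigmab b], which has the same coproduct formula, and both maps are
    multiplicative. *)
Lemma mrcoprod_mrsharp w : mrcoprod (mrsharp q << w >>) =
  \sum_(p <- splits w) mrtensor (mrsharp q << p.1 >>) (mrsharp q << p.2 >>).
Proof.
elim/word_ind: w => [|x w IHw].
  by rewrite big_splits1 malgU1 mrsharp1 mrcoprod1 mrtensor11.
rewrite gen_word mrsharpM mrcoprodM IHw big_splits_cons.
rewrite gen_Sb mrsharp_Sb mrcoprod_sigmab mulr_suml; apply: eq_bigr => i _.
rewrite mulr_sumr; apply: eq_bigr => p _.
by rewrite mrtensorM -!mrsharp_Sb !SbE -!mrsharpM !malgUM.
Qed.

End Sharp.

(** * Reduction of membership to basis elements *)

Section Subspaces.
Variables (K : fieldType) (P : {malg K[word]} -> Prop).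
Hypothesis subP : is_subspace P.
Local Notation MR := {malg K[word]}.

Lemma subspaceD (F G : MR) : P F -> P G -> P (F + G).
Proof. by rewrite -{2}[F]scale1r; apply: subP.2. Qed.

Lemma subspaceZ a (F : MR) : P F -> P (a *: F).
Proof.
by move=> PF; rewrite -[_ *: _]addr0; apply: subP.2 => //; apply: subP.1.
Qed.

Lemma subspace_sum I r (p : pred I) (F : I -> MR) :
  (forall i, p i -> P (F i)) -> P (\sum_(i <- r | p i) F i).
Proof.
by move=> PF; apply: big_ind => //; [apply: subP.1 | apply: subspaceD].
Qed.

Lemma subspace_linear (B : choiceType) (f : {malg K[B]} -> MR) :
  linear f -> (forall b, P (f << b >>)) -> forall F, P (f F).
Proof.
move=> fl Pf; elim/malg_ind => [|a b F IHF]; last by rewrite fl; apply: subP.2.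
have := fl (-1) 0 0; rewrite scaler0 addr0 scaleN1r addNr => ->.
exact: subP.1.
Qed.

End Subspaces.

(** * The image of sharp as a left ideal *)

Section StarIdeal.
Variables (K : fieldType) (q : K).
Local Notation MR := {malg K[word]}.
Implicit Types (F G X Y : MR) (u v w : word).
Local Notation Q := (Qring q).

Lemma Qring_mrsharp F : Q (mrsharp q F).
Proof. by exists F; rewrite mrsharp.unlock. Qed.

Lemma QringP F : Q F -> exists G, F = mrsharp q G.
Proof. by case=> G ->; exists G; rewrite mrsharp.unlock. Qed.

Lemma Qring_subspace : is_subspace Q.
Proof.
split; first by rewrite -(linear0 (@mrsharp K q)); apply: Qring_mrsharp.
move=> a F G /QringP[F' ->] /QringP[G' ->].
by rewrite -(mrsharp_linear q); apply: Qring_mrsharp.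
Qed.

Lemma QringM F G : Q F -> Q G -> Q (F * G).
Proof.
move=> /QringP[F' ->] /QringP[G' ->].
by rewrite -mrsharpM; apply: Qring_mrsharp.
Qed.

Lemma Qring_mrbar F : Q F -> Q (mrbar F).
Proof.
by move=> /QringP[F' ->]; rewrite -mrsharp_mrbar; apply: Qring_mrsharp.
Qed.

Lemma Qring_counit F : Q (mrstar 1 F).
Proof.
rewrite mrstar1; apply: subspaceZ; first exact: Qring_subspace.
by rewrite -(mrsharp1 q); apply: Qring_mrsharp.
Qed.

(** Such products span [Qmod], and their coproduct is again a sum of tensors of such products. *)
Let hs j w : MR := Sb K false j * mrsharp q << w >>.

Let homog_hs j w : homog (j + wdeg w) (hs j w).
Proof. by apply: homogM; [apply: homog_Sb | apply: homog_mrsharp]. Qed.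

Lemma mrstar_mul_hs F1 F2 j w : mrstar (F1 * F2) (hs j w) =
  \sum_(i < j.+1) \sum_(p <- splits w)
     mrstar F1 (hs i p.1) * mrstar F2 (hs (j - i) p.2).
Proof.
rewrite mrstar_mul mrcoprodM mrcoprod_mrsharp mrcoprod_Sb mulr_suml.
rewrite (linear_sum (tmul _ _)); apply: eq_bigr => i _.
rewrite mulr_sumr (linear_sum (tmul _ _)); apply: eq_bigr => p _.
by rewrite mrtensorM /= tmul_tensor.
Qed.

Lemma hs0 w : mrsharp q << w >> = hs 0 w.
Proof. by rewrite /hs mul1r. Qed.

(** Since $\Delta(K^\sharp)$ is a sum of tensors of sharps, splitting reduces to one letter on the
    left, which acts by a projection and possibly a bar. *)
Lemma Qring_mrstar F G : Q G -> Q (mrstar F G).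
Proof.
have Qsub := Qring_subspace.
move=> /QringP[{}G ->]; move: F; apply: subspace_linear => // [a F F'|w].
  exact: mrstar_linearl.
move: G; apply: subspace_linear => // [a F F'|u]; first by rewrite !linearP.
elim/word_ind: w u => [|x w IHw] u; first exact: Qring_counit.
rewrite gen_word hs0 mrstar_mul_hs; apply: subspace_sum => // i _.
(* With [hs 0] on the right, [i] ranges over a single value. *)
apply: subspace_sum => // p _; have -> : nat_of_ord i = 0%N by case: i => -[].
rewrite -!hs0; apply: QringM; last exact: IHw.
rewrite gen_Sb mrstar_Sb (proj_homog _ (homog_mrsharp q _)).
set Y := if _ == _ then _ else _; have QY : Q Y.
  by rewrite /Y; case: ifP => _; [apply: Qring_mrsharp | apply: Qsub.1].
by case: x.1; first apply: Qring_mrbar.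
Qed.

Lemma lam_mrbar n : lam K true n = mrbar (lam K false n).
Proof. by rewrite /lam mrbarZ. Qed.

(** On a homogeneous element the antipode is left internal multiplication by a [lam], which
    preserves [Qring]. *)
Lemma Qring_mrbar_antipode w : Q (mrbar (antipode (mrsharp q << w >>))).
Proof.
apply: Qring_mrbar; rewrite -[X in antipode X](homog_mrsharp q w) -mrstar_lam.
by apply: Qring_mrstar; apply: Qring_mrsharp.
Qed.

(** The antipode reverses $S_aK_1^\sharp$, which puts its image of $S_a$ next to the $S_{j-a}$ of
    the other factor; summing over [a] rebuilds $S_j^\sharp$ in the middle. *)
Lemma mrstar_sigmab_hs n j w : mrstar (sigmab q false n) (hs j w) =
  \sum_(p <- splits w) if n == (j + (wdeg p.1 + wdeg p.2))%N then
    q ^+ wdeg p.1 *: (mrbar (antipode (mrsharp q << p.1 >>)) *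
      (sigmab q false j * mrsharp q << p.2 >>)) else 0.
Proof.
pose A X := mrbar (antipode X).
(* Here [a] is the share of $S_j$ that goes to the first factor; the index splitting [sigmab] is
   eliminated first, as degrees force it. *)
transitivity (\sum_(a < j.+1) \sum_(p <- splits w)
    if n == (j + (wdeg p.1 + wdeg p.2))%N then
      (q ^+ (a + wdeg p.1) *: A (hs a p.1)) * hs (j - a) p.2 else 0).
  rewrite mrstar_suml.
  transitivity (\sum_(i < n.+1) \sum_(a < j.+1) \sum_(p <- splits w)
      (if nat_of_ord i == (a + wdeg p.1)%N
         then q ^+ (a + wdeg p.1) *: A (hs a p.1) else 0) *
      (if (n - i)%N == (j - a + wdeg p.2)%N then hs (j - a) p.2 else 0)).
    apply: eq_bigr => i _; rewrite mrstar_mul_hs.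
    apply: eq_bigr => a _; apply: eq_bigr => p _.
    rewrite mrstarZl lam_mrbar mrstar_mrbar mrstar_lam mrstar_Sb.
    rewrite !(proj_homog _ (homog_hs _ _)) ![(_ + _)%N == _]eq_sym.
    congr (_ * _); case: eqP => [->|_] //.
    by rewrite !linear0.
  rewrite exchange_big; apply: eq_bigr => a _.
  rewrite exchange_big; apply: eq_bigr => p _.
  rewrite [LHS]cauchy_delta; congr (if _ == _ then _ else _).
  by rewrite addnACA subnKC // -ltnS.
rewrite exchange_big; apply: eq_bigr => p _; case: eqP => // _; last first.
  by rewrite big1.
rewrite /sigmab /cauchy mulr_suml mulr_sumr scaler_sumr; apply: eq_bigr => a _.
(* Moves [q ^+ a] onto the barred [lam] and leaves [q ^+ wdeg p.1] outside. *)
have scaleACA (B : lalgType K) (c d : K) (x y z t : B) :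
    (forall u v : B, c *: (u * v) = u * (c *: v)) ->
    (c * d) *: (x * y) * (z * t) = d *: (x * (c *: y * z * t)).
  move=> cAr; rewrite -!scalerAl -cAr scalerA [d * c]mulrC; congr (_ *: _).
  by rewrite !mulrA.
rewrite /A /hs antipodeM antipode_Sb mrbarM -lam_mrbar exprD.
by apply: scaleACA => u v; apply: malg_scalerAr.
Qed.

(** Sharp is multiplicative, so splitting reduces to the sharp of a generator. For an unbarred one,
    [mrstar_sigmab_hs] gives products of three elements of [Qring]; the barred one follows by
    [mrbar]. *)
Lemma Qring_mrstar_hs F j w : Q F -> Q (mrstar F (hs j w)).
Proof.
have Qsub := Qring_subspace.
move=> /QringP[{}F ->]; move: F; apply: subspace_linear => // [a F F'|v].
  by rewrite linearP mrstar_linearl.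
elim/word_ind: v j w => [|x v IHv] j w.
  by rewrite malgU1 mrsharp1; apply: Qring_counit.
rewrite gen_word mrsharpM mrstar_mul_hs; apply: subspace_sum => // i _.
apply: subspace_sum => // p _; apply: QringM => //.
have Qfalse n k u : Q (mrstar (sigmab q false n) (hs k u)).
  rewrite mrstar_sigmab_hs; apply: subspace_sum => // r _.
  case: eqP => _; last exact: Qsub.1.
  apply: subspaceZ => //; apply: QringM; first exact: Qring_mrbar_antipode.
  by rewrite -mrsharp_Sb -mrsharpM; apply: Qring_mrsharp.
rewrite gen_Sb mrsharp_Sb; case: x.1; last exact: Qfalse.
by rewrite -[true]/(~~ false) -mrbar_sigmab mrstar_mrbar; apply: Qring_mrbar.
Qed.

(** * The module generated by the $S_n$ *)

Local Notation QM := (Qmod q).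

Lemma Qmod_subspace : is_subspace QM.
Proof.
have Qsub := Qring_subspace.
split.
  by exists 0%N, (fun=> 0); split=> [_|]; [apply: Qsub.1 | rewrite big_ord0].
move=> a F G [M [X [QX ->]]] [N [Y [QY ->]]].
(* The two sums may have different lengths; [pad] extends both by 0 to the length [maxn M N]. *)
pose pad n (Z : nat -> MR) k := if (k < n)%N then Z k else 0.
have Qpad n Z k : (forall k, Q (Z k)) -> Q (pad n Z k).
  by rewrite /pad; case: ifP => // _ _; apply: Qsub.1.
have padE n p (Z : nat -> MR) : (n <= p)%N ->
    \sum_(k < n) Sn K k * Z k = \sum_(k < p) Sn K k * pad n Z k.
  move=> le_np.
  rewrite (big_ord_widen p (fun k => Sn K k * Z k) le_np) big_mkcond.
  by apply: eq_bigr => k _; rewrite /pad; case: ifP; rewrite ?mulr0.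
exists (maxn M N), (fun k => a *: pad M X k + pad N Y k); split=> [k|].
  by apply: Qsub.2; apply: Qpad.
rewrite (padE M _ _ (leq_maxl M N)) (padE N _ _ (leq_maxr M N)).
rewrite scaler_sumr -big_split.
by apply: eq_bigr => k _; rewrite malg_mull_linear.
Qed.

Lemma Qmod_SnM n F : Q F -> QM (Sn K n * F).
Proof.
have Qsub := Qring_subspace.
move=> QF; exists n.+1, (fun k => if k == n then F else 0); split=> [k|].
  by case: ifP => // _; apply: Qsub.1.
rewrite big_ord_recr /= eqxx big1 ?add0r // => k _.
by rewrite ltn_eqF // mulr0.
Qed.

(** In the splitting, the left factor $S_m$ projects $S_iK_1^\sharp$ onto degree [m], and the other
    factor lies in [Qring] by [Qring_mrstar_hs]. *)
Lemma Qmod_mrstar F G : QM F -> QM G -> QM (mrstar F G).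
Proof.
have Qsub := Qmod_subspace.
move=> [M [X [QX ->]]] [N [Y [QY ->]]].
rewrite mrstar_suml; apply: subspace_sum => // m _.
rewrite (linear_sum (mrstar _)) /=; apply: subspace_sum => // n _.
have /QringP[H ->] := QY n; move: H.
apply: subspace_linear => // [a F' G'|w].
  by rewrite (mrsharp_linear q) malg_mull_linear mrstar_linear.
rewrite -[Sn K n * _]/(hs n w) mrstar_mul_hs.
apply: subspace_sum => // i _; apply: subspace_sum => // p _.
rewrite mrstar_Sb (proj_homog _ (homog_hs _ _)).
case: ifP => _; last by rewrite mul0r; apply: Qsub.1.
rewrite -mulrA; apply: Qmod_SnM; apply: QringM; first exact: Qring_mrsharp.
exact: Qring_mrstar_hs.
Qed.

Theorem Qmod_star_subalgebra :
  is_star_subalgebra QM /\ is_star_left_ideal QM Q.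
Proof.
have starE F G : star F G = mrstar F G by rewrite mrstar.unlock.
split; split; first exact: Qmod_subspace.
- move=> n; rewrite -[Sn K n]mulr1; apply: Qmod_SnM.
  by rewrite -(mrsharp1 q); apply: Qring_mrsharp.
- by move=> F G QF QG; rewrite starE; apply: Qmod_mrstar.
- exact: Qring_subspace.
(* The inclusion uses $S_0=1$. *)
- by move=> F QF; rewrite -[F]mul1r; apply: (@Qmod_SnM 0).
- by move=> F G _ QG; rewrite starE; apply: Qring_mrstar.
Qed.

End StarIdeal.

(** The argument holds over any field and for any [q]; the complex and the indeterminate case are
    two instances. *)
Theorem theorem5p1 (R : realType) :
  (forall q : R[i]%C,
     is_star_subalgebra (Qmod q) /\ is_star_left_ideal (Qmod q) (Qring q)) /\
  (let q : {fraction {poly R[i]%C}} := tofrac 'X in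
     is_star_subalgebra (Qmod q) /\ is_star_left_ideal (Qmod q) (Qring q)).
Proof.
by split=> [q|]; apply: Qmod_star_subalgebra.
Qed.
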